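(* If $\mathcal V$ and $\mathcal V^\vee$ are Gale dual signed vector arrangements over $\Bbbk$, then there is an isomorphism of chain complexes $$\mathcal T(\mathcal V)\cong\mathcal T(\mathcal V^\vee).$$
   Context: Let $\Bbbk$ be a field of characteristic zero. A signed vector arrangement $\mathcal V=\{V;\nu_1,\dots,\nu_n\}$ is a finite-dimensional $\Bbbk$-vector space $V$ with an inner product, a list of vectors $\nu_i\in V$ (zero allowed) and a sign for each $\nu_i$, giving a partition $[n]=\{1,\dots,n\}=[n]_+\sqcup[n]_-$. For $S\subseteq[n]$: $H_S=\bigcap_{s\in S}\nu_s^\perp$ ($H_\emptyset=V$), $V_S=\mathrm{span}\{\nu_s\}_{s\in S}$, $W=\{w\in\Bbbk^n:\sum w_i\nu_i=0\}$ with inner product induced from the standard one on $\Bbbk^n$, $W_S=\{w\in W:w_r=0\text{ for }r\notin S\}$, $\widetilde S=(S\cap[n]_+)\cup([n]_-\setminus S)$. The vector $\nu_r^\vee\in W$ is the orthogonal projection of the $r$-th standard basis vector of $\Bbbk^n$ to $W$ (it represents the coordinate functional $w\mapsto w_r$). Inner products are understood to restrict non-degenerately to all subspaces onto which orthogonal projections are taken. Gale dual: $\mathcal V^\vee=\{W;\nu_1^\vee,\dots,\nu_n^\vee\}$, where the sign of $\nu_i^\vee$ is opposite to the sign of $\nu_i$. Complex $\mathcal T(\mathcal V)=\bigoplus_{S\subseteq[n]}T_S$, $T_S=\bigwedge^\bullet H_{\widetilde S}\otimes\bigwedge^\bullet W_{\widetilde S}$, with (integer or half-integer) bigrading $\deg(\bigwedge^iH_{\widetilde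 S}\otimes\bigwedge^jW_{\widetilde S})=(|S|-n/2,\ |S|+\dim H_{\widetilde S}+\dim W_{\widetilde S}-2(i+j)-n/2)$; the first degree is homological. For $r\notin S$, $\delta_{S,r}:T_S\to T_{S\cup r}$ is: (1) if $r\in[n]_+$, $\nu_r\notin V_{\widetilde S}$: (map induced by orthogonal projection $H_{\widetilde S}\to H_{\widetilde S\cup r}$) $\otimes$ (inclusion $W_{\widetilde S}\subseteq W_{\widetilde S\cup r}$); (2) if $r\in[n]_+$, $\nu_r\in V_{\widetilde S}$: (projection) $\otimes$ (inclusion into $\bigwedge^\bullet W_{\widetilde S\cup r}$ followed by left wedge with the projection of $\nu_r^\vee$ to $W_{\widetilde S\cup r}$); (3) if $r\in[n]_-$, $\nu_r\in V_{\widetilde S-r}$: (inclusion $H_{\widetilde S}\subseteq H_{\widetilde S-r}$) $\otimes$ (orthogonal projection $W_{\widetilde S}\to W_{\widetilde S-r}$); (4) if $r\in[n]_-$, $\nu_r\notin V_{\widetilde S-r}$: (inclusion into $\bigwedge^\bullet H_{\widetilde S-r}$ followed by left wedge with the projection of $\nu_r$ to $H_{\widetilde S-r}$) $\otimes$ (projection). The differential is $\delta=\bigoplus_{S,\,r\notin S}\epsilon_{S,r}\delta_{S,r}$ for a choice of nonzero scalars $\epsilon_{S,r}\in\Bbbk^\times$ making every square of the cube anticommute (such a choice exists, and a different choice does not change the homology). $\delta$ has bidegree $(1,0)$.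
   Formalization: Adds that the vectors ν_i span V (false otherwise: n = 0, V = k) and that the inner products are nondegenerate on all H_S and W_S for both arrangements, not only on projection targets; the same scalars ε are used in both complexes. *)

(* Defs.v *)
From HB Require Import structures.
From mathcomp Require Import all_boot all_order all_algebra.

Set Implicit Arguments.
Unset Strict Implicit.
Unset Printing Implicit Defensive.

Import GRing.Theory.
Local Open Scope ring_scope.

Section InnerProducts.
Variables (k : fieldType) (V : vectType k).

Definition nondeg_on (b : {symmetric V}) (U : {vspace V}) : Prop :=
  (U :&: orthov b U)%VS = 0%VS.

(* Orthogonal projection onto U.  It is meaningful when nondeg_on b U holds:  *)
(* V is then the direct sum of U and orthov b U.  The orthogonal projection   *)
(* from a larger subspace U' to U is the restriction of this map to U'.       *)
Definition oproj (b : {symmetric V}) (U : {vspace V}) : 'End(V) :=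
  daddv_pi U (orthov b U).

Definition sub_form (b : {symmetric V}) (U : {vspace V}) (x y : subvs_of U) : k :=
  b (vsval x) (vsval y).

End InnerProducts.

Section SubForm.
Variables (k : fieldType) (V : vectType k) (b : {symmetric V}) (U : {vspace V}).

Fact sub_form_bilinear : bilinear_for *%R (idfun \; *%R) (@sub_form k V b U).
Proof.
split=> u a x y; rewrite /sub_form.
  by rewrite [vsval (_ + _)]linearP linearPl.
by rewrite [vsval (_ + _)]linearP linearPr.
Qed.

HB.instance Definition _ :=
  bilinear_isBilinear.Build k (subvs_of U) (subvs_of U) k _ _
    (@sub_form k V b U) sub_form_bilinear.

Fact sub_form_sym (x y : subvs_of U) :
  sub_form b x y = (-1) ^+ false * idfun (sub_form b y x).
Proof. exact: hermC. Qed.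

HB.instance Definition _ :=
  isHermitianSesquilinear.Build k (subvs_of U) false idfun
    (@sub_form k V b U) sub_form_sym.

End SubForm.

Section StandardForm.
Variables (k : fieldType) (n : nat).

Definition dotmx (u v : 'rV[k]_n) : k := \sum_i u 0 i * v 0 i.

Fact dotmx_bilinear : bilinear_for *%R (idfun \; *%R) dotmx.
Proof.
by split=> u a x y; rewrite /dotmx /= mulr_sumr -big_split; apply: eq_bigr => i _;
  rewrite !mxE ?mulrDl ?mulrDr ?mulrA // [u _ _ * a]mulrC.
Qed.

HB.instance Definition _ :=
  bilinear_isBilinear.Build k 'rV[k]_n 'rV[k]_n k _ _ dotmx dotmx_bilinear.

Fact dotmx_sym (u v : 'rV[k]_n) : dotmx u v = (-1) ^+ false * idfun (dotmx v u).
Proof. by rewrite expr0 mul1r; apply: eq_bigr => i _; rewrite mulrC. Qed.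

HB.instance Definition _ :=
  isHermitianSesquilinear.Build k 'rV[k]_n false idfun dotmx dotmx_sym.

End StandardForm.

(* The exterior algebra of U, in Grassmann's model: x I is the coefficient of  *)
(* e_i1 /\ ... /\ e_im, where I = {i1 < ... < im} and (e_i) is the basis       *)
(* vbasis fullv of U.                                                         *)
Notation exterior k U := {ffun {set 'I_(\dim {:U})} -> k^o}.

(* The tensor product of two exterior algebras, with basis the pairs of basis  *)
(* elements.                                                                  *)
Notation exterior2 k U1 U2 :=
  {ffun {set 'I_(\dim {:U1})} * {set 'I_(\dim {:U2})} -> k^o}.

Section Exterior.
Variable k : fieldType.

(* Left wedge with the vector u: e_i /\ e_I is 0 if i \in I, and otherwise is  *)
(* (-1)^m e_(i |: I), where m is the number of elements of I smaller than i.  *)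
Definition wedge (U : vectType k) (u : U) (x : exterior k U) : exterior k U :=
  [ffun J : {set 'I_(\dim {:U})} =>
     \sum_(i in J) (-1) ^+ #|[set j in J | (j < i)%N]| *
                   coord (vbasis {:U}) i u * x (J :\ i)].

Definition wedge_seq (U : vectType k) (s : seq U) : exterior k U :=
  foldr (@wedge U) [ffun I => (I == set0)%:R] s.

(* The algebra morphism induced by f. *)
Definition ext_map (U1 U2 : vectType k) (f : U1 -> U2) (x : exterior k U1) :
    exterior k U2 :=
  \sum_(I : {set 'I_(\dim {:U1})})
     x I *: wedge_seq [seq f (vbasis {:U1})`_i | i : 'I_(\dim {:U1}) <- enum I].

(* The j-th exterior power of a subspace H of U, as a subspace of the exterior *)
(* algebra of U.                                                              *)
Definition ext_pow (U : vectType k) (H : {vspace U}) (j : nat) :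
    {vspace exterior k U} :=
  <<[seq wedge_seq [seq (vbasis H)`_i | i : 'I_(\dim H) <- enum J]
      | J : {set 'I_(\dim H)} in [set J : {set 'I_(\dim H)} | #|J| == j]]>>%VS.

Section Tensor.
Variables U1 U2 : vectType k.

Definition tens (x : exterior k U1) (y : exterior k U2) : exterior2 k U1 U2 :=
  [ffun p => x p.1 * y p.2].

Definition tensv (X : {vspace exterior k U1}) (Y : {vspace exterior k U2}) :
    {vspace exterior2 k U1 U2} :=
  <<[seq tens x y | x <- vbasis X, y <- vbasis Y]>>%VS.

(* The tensor product of the linear maps f and g. *)
Definition tens_map (f : exterior k U1 -> exterior k U1)
    (g : exterior k U2 -> exterior k U2) (t : exterior2 k U1 U2) : exterior2 k U1 U2 :=
  \sum_p t p *: tens (f [ffun I => (I == p.1)%:R]) (g [ffun J => (J == p.2)%:R]).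

End Tensor.
End Exterior.

Record signed_arrangement (k : fieldType) (n : nat) := SignedArrangement {
  sa_space : vectType k;
  sa_form : {symmetric sa_space};
  sa_vec : 'I_n -> sa_space;
  sa_pos : {set 'I_n}
}.

Section Arrangement.
Variables (k : fieldType) (n : nat) (A : signed_arrangement k n).

Local Notation V := (sa_space A).
Local Notation nu := (@sa_vec k n A).
Local Notation pos := (sa_pos A).
Local Notation Kn := 'rV[k]_n.
Local Notation dot := (@dotmx k n : {symmetric Kn}).

Implicit Types (S : {set 'I_n}) (r : 'I_n).

Definition sa_H S : {vspace V} :=
  (\bigcap_(s in S) orthov (sa_form A) <[nu s]>)%VS.

Definition sa_V S : {vspace V} := (\sum_(s in S) <[nu s]>)%VS.

Definition sa_W : {vspace Kn} :=
  lker (linfun (fun w : Kn => \sum_i w 0 i *: nu i)).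

Definition sa_WS S : {vspace Kn} :=
  (sa_W :&:
   \bigcap_(r | r \notin S) lker (linfun (fun w : Kn => (w 0%R r : k^o))))%VS.

Definition sa_tilde S : {set 'I_n} := (S :&: pos) :|: (~: pos :\: S).

(* nu_r^\vee, as a vector of k^n lying in W *)
Definition sa_covec r : Kn := oproj dot sa_W (delta_mx 0 r).

Definition gale_dual : signed_arrangement k n :=
  @SignedArrangement k n (subvs_of sa_W) (sub_form dot (U := sa_W))
    (fun r => vsproj sa_W (sa_covec r)) (~: pos).

Definition spanning : Prop := sa_V setT = fullv.

(* The standing convention that inner products restrict non-degenerately to   *)
(* the subspaces onto which one projects; S = set0 is V itself in the first   *)
(* clause, and S = setT is W in the second one.                               *)
Definition nondegenerate_arrangement : Prop :=
  (forall S, nondeg_on (sa_form A) (sa_H S)) /\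
  (forall S, nondeg_on dot (sa_WS S)).

Local Notation E := (exterior2 k V Kn).

Definition T_bipart S (i j : nat) : {vspace E} :=
  tensv (ext_pow (sa_H (sa_tilde S)) i) (ext_pow (sa_WS (sa_tilde S)) j).

Definition T_S S : {vspace E} :=
  (\sum_(i < (\dim (sa_H (sa_tilde S))).+1)
     \sum_(j < (\dim (sa_WS (sa_tilde S))).+1) T_bipart S i j)%VS.

Definition hdeg S : rat := #|S|%:R - n%:R / 2.

Definition qdeg S (i j : nat) : rat :=
  #|S|%:R + (\dim (sa_H (sa_tilde S)))%:R + (\dim (sa_WS (sa_tilde S)))%:R
  - 2 * (i + j)%:R - n%:R / 2.

(* delta_{S,r}, as a map on the ambient space E of all the T_S, in which       *)
(* inclusions are identities.  Only its values on T_S, for r \notin S, matter. *)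
(* B is the set sa_tilde (r |: S).                                            *)
Definition edge_map S r (t : E) : E :=
  if r \in pos then
    let B := r |: sa_tilde S in
    let pH := ext_map (oproj (sa_form A) (sa_H B)) in
    if nu r \notin sa_V (sa_tilde S) then tens_map pH id t
    else tens_map pH (wedge (oproj dot (sa_WS B) (sa_covec r))) t
  else
    let B := sa_tilde S :\ r in
    let pW := ext_map (oproj dot (sa_WS B)) in
    if nu r \in sa_V B then tens_map id pW t
    else tens_map (wedge (oproj (sa_form A) (sa_H B) (nu r))) pW t.

Fact edge_map_is_linear S r : linear (edge_map S r).
Proof.
have tlin f g : linear (@tens_map k V Kn f g).
  move=> a x y; rewrite /tens_map scaler_sumr -big_split; apply: eq_bigr => p _.
  by rewrite !ffunE scalerDl scalerA.
by move=> a x y; rewrite /edge_map; case: ifP => _; case: ifP => _; apply: tlin.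
Qed.

HB.instance Definition _ S r :=
  GRing.isLinear.Build k E E *:%R (edge_map S r) (edge_map_is_linear S r).

(* A choice of the scalars epsilon_{S,r}: nonzero on the edges of the cube,    *)
(* and making every square anticommute; eps S r is irrelevant when r \in S.   *)
Definition edge_choice (eps : {set 'I_n} -> 'I_n -> k) : Prop :=
  (forall S r, r \notin S -> eps S r != 0) /\
  (forall S r s, r \notin S -> s \notin S -> r != s ->
   forall t, t \in T_S S ->
     (eps S r * eps (r |: S) s) *: edge_map (r |: S) s (edge_map S r t) =
     - ((eps S s * eps (s |: S) r) *: edge_map (s |: S) r (edge_map S s t))).

(* The direct sum of the T_S and its bihomogeneous parts, as subspaces of the  *)
(* space of all the families (t S)_S of elements of E.                        *)
Local Notation F := {ffun {set 'I_n} -> E}.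

Definition ffun_eval S (t : F) : E := t S.

Fact ffun_eval_is_linear S : linear (ffun_eval S).
Proof. by move=> a x y; rewrite /ffun_eval !ffunE. Qed.

HB.instance Definition _ S :=
  GRing.isLinear.Build k F E *:%R (ffun_eval S) (ffun_eval_is_linear S).

Definition T_in (P : {set 'I_n} -> {vspace E}) : {vspace F} :=
  (\bigcap_S linfun (ffun_eval S) @^-1: P S)%VS.

Definition T_total : {vspace F} := T_in T_S.

Definition T_piece (p q : rat) : {vspace F} :=
  T_in (fun S =>
    \sum_(i < (\dim (sa_H (sa_tilde S))).+1)
      \sum_(j < (\dim (sa_WS (sa_tilde S))).+1 |
            (hdeg S == p) && (qdeg S i j == q)) T_bipart S i j)%VS.

Definition T_diff (eps : {set 'I_n} -> 'I_n -> k) (t : F) : F :=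
  [ffun S : {set 'I_n} =>
     \sum_(r in S) eps (S :\ r) r *: edge_map (S :\ r) r (t (S :\ r))].

Lemma T_totalP (t : F) : reflect (forall S, t S \in T_S S) (t \in T_total).
Proof.
have evalE S : linfun (ffun_eval S) t = t S by rewrite lfunE.
apply: (iffP idP) => [tT S | tT].
  rewrite -evalE memv_preim; move: tT; rewrite !memvE => /subv_trans; apply.
  exact: (bigcapv_inf S).
rewrite memvE; apply/subv_bigcapP => S _.
by rewrite -memvE -memv_preim evalE; apply: tT.
Qed.

Lemma T_diff_sq eps : edge_choice eps ->
  {in T_total, forall t, T_diff eps (T_diff eps t) = 0}.
Proof.
move=> [_ anti] t /T_totalP tT; apply/ffunP => S; rewrite [LHS]ffunE [RHS]ffunE.
pose G s r := (eps (S :\ s :\ r) r * eps (S :\ s) s) *: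
  edge_map (S :\ s) s (edge_map (S :\ s :\ r) r (t (S :\ s :\ r))).
transitivity (\sum_(s in S) \sum_(r in S | r != s) G s r).
  apply: eq_bigr => s sS; rewrite ffunE linear_sum scaler_sumr.
  apply: eq_big => [r | r _]; first by rewrite !inE andbC.
  by rewrite linearZ scalerA mulrC.
have antiG s r : s \in S -> r \in S -> r != s -> G s r = - G r s.
  move=> sS rS nrs; pose S0 := S :\ s :\ r.
  have ES : S :\ r :\ s = S0 by rewrite /S0 !setDDl setUC.
  have Er : S :\ s = r |: S0 by rewrite setD1K // !inE nrs.
  have Es : S :\ r = s |: S0 by rewrite -ES setD1K // !inE eq_sym nrs.
  rewrite /G ES -/S0 Er Es; apply: anti; last exact: tT.
  - by rewrite !inE eqxx.
  - by rewrite !inE eqxx andbF.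
  - exact: nrs.
transitivity (\sum_(s in S) \sum_(r in S | (r < s)%N) (G s r + G r s)).
  transitivity (\sum_(s in S) (\sum_(r in S | (r < s)%N) G s r +
                               \sum_(r in S | (s < r)%N) G s r)).
    apply: eq_bigr => s _; rewrite (bigID (fun r : 'I_n => (r < s)%N)) /=.
    by congr (_ + _); apply: eq_bigl => r; rewrite -andbA; congr (_ && _);
      rewrite -val_eqE /=; case: ltngtP.
  rewrite big_split /= [X in _ + X](exchange_big_dep (mem S)) /=; last first.
    by move=> s r _ /andP[].
  rewrite -big_split; apply: eq_bigr => s sS /=; rewrite big_split /=.
  by congr (_ + _); apply: eq_bigl => r; rewrite sS.
rewrite big1 // => s sS; rewrite big1 // => r /andP[rS lt_rs].
by rewrite antiG ?addNr // -val_eqE neq_ltn lt_rs.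
Qed.

End Arrangement.

(* Isomorphism between the bigraded chain complexes T(A) and T(B), formed with *)
(* the scalars epsA and epsB.                                                 *)
Definition T_iso (k : fieldType) (n : nat) (A B : signed_arrangement k n)
    (epsA epsB : {set 'I_n} -> 'I_n -> k) : Prop :=
  exists f : 'Hom({ffun {set 'I_n} -> exterior2 k (sa_space A) 'rV[k]_n},
                  {ffun {set 'I_n} -> exterior2 k (sa_space B) 'rV[k]_n}),
    [/\ {in T_total A &, injective f},
        (f @: T_total A)%VS = T_total B,
        forall p q, (f @: T_piece A p q)%VS = T_piece B p q
      & {in T_total A, forall t, f (T_diff epsA t) = T_diff epsB (f t)}].

(* Main.v *)
From HB Require Import structures.
Require Import Defs.
From mathcomp Require Import all_boot all_order all_algebra.

(** Write [W] for the space of relations and [T] for [sa_tilde A S], so that the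
    corresponding set for the dual arrangement is [~: T] ([sa_tilde_dual]).

    One tensor factor is the same on both sides: the dual vector of [s] represents the
    [s]-th coordinate on [W], so the subspace of [W] orthogonal to the dual vectors
    outside [T] is [sa_WS A T] ([mem_dual_H]).

    The other factor needs an identification of [sa_H A T] with the space of dual
    relations supported outside [T]. The first is the orthogonal complement in [V] of
    the span of the [nu s], [s \in T], hence a model of the quotient of [V] by that span.
    The second is the orthogonal complement in [k^n] of [W] together with the unit
    vectors [e_s], [s \in T]. As [V] is spanned by the [nu s], it is [k^n / W], so both
    are models of the same quotient. The isomorphism [gale_H T] lifts a vector of [V] to
    [k^n] and projects the lift; its inverse combines the [nu s] and projects. In this
    description an orthogonal projection to a smaller subspace is a quotient map, and
    the projection of [nu r] corresponds to the projection of [e_r] ([gale_H_oproj],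
    [gale_H_sub], [gale_H_vec]). An inclusion occurs in the differential in two
    situations. If [nu r] is in the span of the remaining vectors, the inclusion is an
    equality on both sides ([dual_WS_setU1_eq]). Otherwise it is followed by the wedge
    with the projection of [nu r], and it agrees with a section of the quotient map up
    to multiples of the vector being wedged ([hyperplane_oproj], [wedge_seq_modl]).

    Exchanging the two factors therefore turns each edge map of [A] into the edge map of
    the dual. The sign of [r] is reversed, and [nu r] is dependent on the vectors of [T]
    exactly when its dual vector is independent of those outside [r |: T]
    ([dual_vec_in_V]), so the kinds of edges match ([gale_T_edge]). The bidegree is
    symmetric in the two factors. All these verifications take place on products of
    vectors, because exterior powers are spanned by them and the induced maps act on
    them vector by vector ([T_S_eq], [ext_map_seq]). *)

Set Implicit Arguments.
Unset Strict Implicit.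
Unset Printing Implicit Defensive.

Import GRing.Theory.
Local Open Scope ring_scope.

(** * The exterior algebra *)

Section Wedge.
Variables (k : fieldType) (U : vectType k).
Implicit Types (u v : U) (x : exterior k U) (s : seq U).

Local Notation sgn J i := ((-1) ^+ #|[set j in J | (j < i)%N]| : k).

Fact wedge_is_linear u : linear (wedge u).
Proof.
move=> a x y; apply/ffunP => J; rewrite !ffunE scaler_sumr -big_split /=.
by apply: eq_bigr => i _; rewrite !ffunE mulrDr -[a *: _]/(a * _) mulrCA.
Qed.

HB.instance Definition _ u :=
  GRing.isLinear.Build k (exterior k U) (exterior k U) *:%R (wedge u)
    (wedge_is_linear u).

Lemma wedgePl a u v x : wedge (a *: u + v) x = a *: wedge u x + wedge v x.
Proof.
apply/ffunP => J; rewrite !ffunE scaler_sumr -big_split /=.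
apply: eq_bigr => i _; rewrite linearP /= mulrDr mulrDl; congr (_ + _).
by rewrite -[a *: _]/(a * _) !mulrA [a * _]mulrC.
Qed.

Lemma wedgeDl u v x : wedge (u + v) x = wedge u x + wedge v x.
Proof. by rewrite -[u]scale1r wedgePl !scale1r. Qed.

Lemma wedge0l x : wedge 0 x = 0.
Proof. by apply: (addrI (wedge 0 x)); rewrite -wedgeDl !addr0. Qed.

Lemma wedgeZl a u x : wedge (a *: u) x = a *: wedge u x.
Proof. by rewrite -[a *: u]addr0 wedgePl wedge0l addr0. Qed.

Lemma wedge_suml (I : Type) (r : seq I) (P : pred I) (F : I -> U) x :
  wedge (\sum_(i <- r | P i) F i) x = \sum_(i <- r | P i) wedge (F i) x.
Proof.
by apply: (big_morph (fun u => wedge u x)) => [u v|]; rewrite ?wedgeDl ?wedge0l.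
Qed.

(** Removing the smaller of two elements of [J] changes by one the rank of the
    larger, and removing the larger does not change the rank of the smaller. *)
Lemma wedge_sign_swap (J : {set 'I_(\dim {:U})}) (i j : 'I_(\dim {:U})) :
  i \in J -> (i < j)%N ->
  sgn J i * sgn (J :\ i) j = - (sgn J j * sgn (J :\ j) i).
Proof.
move=> iJ ltij.
have -> : [set l in J :\ j | (l < i)%N] = [set l in J | (l < i)%N].
  apply/setP => l; rewrite !inE; case: eqP => [->|_] //=.
  by rewrite ltnNge ltnW ?andbF.
have -> : [set l in J :\ i | (l < j)%N] = [set l in J | (l < j)%N] :\ i.
  by apply/setP => l; rewrite !inE andbA.
rewrite [in RHS](cardsD1 i [set l in J | (l < j)%N]) !inE iJ ltij exprD expr1.
by rewrite mulN1r mulNr opprK mulrC.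
Qed.

(** In the coefficient of [J], the terms of the pairs [(i, j)] and [(j, i)] have
    opposite signs; pairing them avoids dividing by two. *)
Lemma wedge_self u x : wedge u (wedge u x) = 0.
Proof.
apply/ffunP => J; rewrite !ffunE.
pose c (i : 'I_(\dim {:U})) : k := coord (vbasis {:U}) i u.
pose G (i j : 'I_(\dim {:U})) : k :=
  (sgn J i * sgn (J :\ i) j) * (c i * c j) * x (J :\ i :\ j).
transitivity (\sum_(i in J) \sum_(j in J | j != i) G i j).
  apply: eq_bigr => i iJ; rewrite ffunE mulr_sumr; apply: eq_big => [j|j _].
    by rewrite !inE andbC.
  by rewrite /G /c !mulrA; congr (_ * _); rewrite -!mulrA; congr (_ * _); rewrite mulrCA.
have antiG i j : i \in J -> j \in J -> (i < j)%N -> G i j = - G j i.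
  move=> iJ jJ lt_ij; rewrite /G wedge_sign_swap // [c j * c i]mulrC.
  have -> : J :\ j :\ i = J :\ i :\ j by rewrite !setDDl setUC.
  by rewrite !mulNr.
transitivity (\sum_(i in J) \sum_(j in J | (i < j)%N) (G i j + G j i)); last first.
  by rewrite big1 // => i iJ; rewrite big1 // => j /andP[jJ ij]; rewrite antiG // addNr.
transitivity (\sum_(i in J) (\sum_(j in J | (i < j)%N) G i j +
                             \sum_(j in J | (j < i)%N) G i j)).
  apply: eq_bigr => i _; rewrite (bigID (fun j : 'I_(\dim {:U}) => (i < j)%N)) /=.
  by congr (_ + _); apply: eq_bigl => j; rewrite -andbA; congr (_ && _);
    rewrite -val_eqE /=; case: ltngtP.
rewrite big_split /= [X in _ + X](exchange_big_dep (mem J)) /=; last first.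
  by move=> i j _ /andP[].
rewrite -big_split; apply: eq_bigr => i iJ /=; rewrite big_split /=.
by congr (_ + _); apply: eq_bigl => j; rewrite iJ.
Qed.

(** Polarization of [wedge_self]. *)
Lemma wedge_anticomm u v x : wedge u (wedge v x) = - wedge v (wedge u x).
Proof.
have := wedge_self (u + v) x; rewrite !wedgeDl !linearD /= !wedge_self add0r addr0.
by move/eqP; rewrite addr_eq0 => /eqP.
Qed.

Lemma wedge_seq_move v s1 s2 :
  wedge v (wedge_seq (s1 ++ s2)) = (-1) ^+ size s1 *: wedge_seq (s1 ++ v :: s2).
Proof.
elim: s1 => [|u s1 IHs] /=; first by rewrite scale1r.
by rewrite wedge_anticomm IHs linearZ exprS mulN1r scaleNr.
Qed.

Lemma wedge_seq_mem v s : v \in s -> wedge v (wedge_seq s) = 0.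
Proof.
elim: s => //= u s IHs; rewrite inE => /orP[/eqP->|/IHs vs0].
  exact: wedge_self.
by rewrite wedge_anticomm vs0 linear0 oppr0.
Qed.

(** Moving [a] next to a later vector turns each multiple of [a] in that vector into
    a factor [wedge a (wedge a _)], which vanishes. *)
Lemma wedge_seq_modl (T : vectType k) (f g : T -> U) a (t : seq T) :
    {in t, forall z, f z - g z \in <[a]>%VS} ->
  wedge_seq (a :: map f t) = wedge_seq (a :: map g t).
Proof.
elim: t => //= z t IHt fg.
have /vlineP[c fz] := fg z (mem_head z t).
have {IHt} /= IHt := IHt (fun y yt => fg y (mem_behead (s := z :: t) yt)).
rewrite -(subrK (g z) (f z)) fz wedgePl linearD linearZ /= wedge_self scaler0 add0r.
by rewrite wedge_anticomm IHt -wedge_anticomm.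
Qed.

Lemma enum_setU1_ord m (i : 'I_m) (I : {set 'I_m}) : i \notin I ->
  exists t1 t2, [/\ enum I = t1 ++ t2, enum (i |: I) = t1 ++ i :: t2
                  & size t1 = #|[set j in I | (j < i)%N]|].
Proof.
move=> iI; pose lto (x y : 'I_m) := (x < y)%N.
have lto_tr : transitive lto by move=> y x z; apply: ltn_trans.
have lto_irr : irreflexive lto by move=> x; apply: ltnn.
have enum_sorted (J : {set 'I_m}) : sorted lto (enum J).
  rewrite /enum_mem -enumT; apply: sorted_filter => //.
  by have := iota_ltn_sorted 0 m; rewrite -val_enum_ord sorted_map.
have part_sorted a : sorted lto (filter a (enum I)).
  by apply: sorted_filter (enum_sorted I).
have mem_part a j : (j \in filter a (enum I)) = a j && (j \in I).
  by rewrite mem_filter mem_enum.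
pose t1 := [seq j : 'I_m <- enum I | (j < i)%N].
pose t2 := [seq j : 'I_m <- enum I | (i < j)%N].
have t12 : enum I = t1 ++ t2.
  apply: (irr_sorted_eq lto_tr lto_irr) => //.
    rewrite (sorted_pairwise lto_tr) pairwise_cat -!(sorted_pairwise lto_tr).
    rewrite !part_sorted !andbT; apply/allrelP => x y.
    by rewrite !mem_part => /andP[xi _] /andP[iy _]; apply: ltn_trans xi iy.
  move=> j; rewrite mem_cat !mem_part mem_enum -andb_orl.
  case: ltngtP => //= /val_inj->; exact: negbTE.
exists t1, t2; split=> //.
  apply: (irr_sorted_eq lto_tr lto_irr) => //.
    rewrite (sorted_pairwise lto_tr) pairwise_cat /= -!(sorted_pairwise lto_tr).
    rewrite !part_sorted !andbT; apply/andP; split; last first.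
      by apply/allP => y; rewrite mem_part => /andP[].
    apply/allrelP => x y; rewrite inE !mem_part => /andP[xi _].
    by case/orP=> [/eqP-> //|/andP[iy _]]; apply: ltn_trans xi iy.
  move=> j; rewrite mem_cat inE mem_enum !inE !mem_part.
  by rewrite -val_eqE /=; case: ltngtP => _; rewrite ?orbF ?orbT.
rewrite cardE; apply/perm_size/uniq_perm; rewrite ?enum_uniq //.
  exact/filter_uniq/enum_uniq.
by move=> j; rewrite mem_part mem_enum !inE andbC.
Qed.

(** Inserting [b i] in its place among the sorted [b j], [j \in I], takes as many
    transpositions as [I] has elements smaller than [i]. *)
Lemma wedge_family m (b : 'I_m -> U) (i : 'I_m) (I : {set 'I_m}) :
  wedge (b i) (wedge_seq [seq b j | j <- enum I]) =
  if i \in I then 0 else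
    (-1) ^+ #|[set j in I | (j < i)%N]| *: wedge_seq [seq b j | j <- enum (i |: I)].
Proof.
case: ifP => [iI|/negbT iI].
  by apply: wedge_seq_mem; apply: map_f; rewrite mem_enum.
have [t1 [t2 [-> -> <-]]] := enum_setU1_ord iI.
by rewrite !map_cat wedge_seq_move size_map.
Qed.

End Wedge.

Section ExtMap.
Variables (k : fieldType).

Fact ext_map_is_linear (U1 U2 : vectType k) (f : U1 -> U2) : linear (ext_map f).
Proof.
move=> a x y; rewrite /ext_map scaler_sumr -big_split; apply: eq_bigr => I _.
by rewrite !ffunE scalerDl scalerA.
Qed.

HB.instance Definition _ (U1 U2 : vectType k) (f : U1 -> U2) :=
  GRing.isLinear.Build k (exterior k U1) (exterior k U2) *:%R (ext_map f)
    (ext_map_is_linear f).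

Definition ext_delta (U : vectType k) (I : {set 'I_(\dim {:U})}) : exterior k U :=
  [ffun J => (J == I)%:R].

Lemma ext_sum_delta (U : vectType k) (x : exterior k U) :
  x = \sum_I x I *: ext_delta I.
Proof.
apply/ffunP => J; rewrite sum_ffunE (bigD1 J) //= big1 ?addr0 => [|I nIJ].
  by rewrite !ffunE eqxx [_ *: _]mulr1.
by rewrite !ffunE eq_sym (negbTE nIJ) [_ *: _]mulr0.
Qed.

Lemma ext_map_delta (U1 U2 : vectType k) (f : U1 -> U2) I :
  ext_map f (ext_delta I) =
  wedge_seq [seq f (vbasis {:U1})`_i | i : 'I_(\dim {:U1}) <- enum I].
Proof.
rewrite /ext_map (bigD1 I) //= big1 ?addr0 ?ffunE ?eqxx ?scale1r // => J nJI.
by rewrite ffunE (negbTE nJI) scale0r.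
Qed.

Lemma wedge_delta (U : vectType k) (i : 'I_(\dim {:U})) I :
  wedge (vbasis {:U})`_i (ext_delta I) =
  if i \in I then 0 else (-1) ^+ #|[set j in I | (j < i)%N]| *: ext_delta (i |: I).
Proof.
apply/ffunP => J; rewrite ffunE.
have cE j : coord (vbasis {:U}) j (vbasis {:U})`_i = (j == i)%:R.
  by rewrite coord_free 1?eq_sym // (basis_free (vbasisP _)).
rewrite big_mkcond (bigD1 i) //= big1 ?addr0 => [|j nji]; last first.
  by rewrite cE (negbTE nji) mulr0 mul0r if_same.
rewrite cE eqxx mulr1 ffunE.
case: (boolP (i \in I)) => iI.
  rewrite !ffunE; case: ifP => // _; case: eqP => [JI|_]; last by rewrite mulr0.
  by move: iI; rewrite -JI setD11.
rewrite !ffunE; case: ifP => iJ; last first.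
  by case: eqP iJ => [->|_ _]; rewrite ?setU11 // [_ *: _]mulr0.
have -> : (J :\ i == I) = (J == i |: I).
  by apply/eqP/eqP => [<-|->]; rewrite ?setD1K ?setU1K.
case: eqP => [->|_]; last by rewrite mulr0 [_ *: _]mulr0.
rewrite [RHS]mulr1 mulr1; congr (_ ^+ _); apply: eq_card => j; rewrite !inE.
by case: (eqVneq j i) => [->|//]; rewrite ltnn !andbF.
Qed.

(** By linearity this is a statement on basis elements. There [f] carries a product
    of basis vectors to the product of their images, and [wedge_family] reorders both
    products with the same sign. *)
Lemma ext_map_wedge (U1 U2 : vectType k) (f : {linear U1 -> U2}) u x :
  ext_map f (wedge u x) = wedge (f u) (ext_map f x).
Proof.
rewrite {1}(coord_vbasis (memvf u)) {2}(coord_vbasis (memvf u)).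
rewrite wedge_suml [LHS]linear_sum [f _]linear_sum wedge_suml /=; apply: eq_bigr => i _.
rewrite linearZ !wedgeZl linearZ /=; congr (_ *: _).
have [c ->] : exists c, x = \sum_I c I *: ext_delta I.
  by exists x; apply: ext_sum_delta.
rewrite [wedge _ (\sum_I _)]linear_sum [LHS]linear_sum.
rewrite [ext_map f (\sum_I _)]linear_sum [RHS]linear_sum.
apply: eq_bigr => I _ /=; rewrite [wedge _ _]linearZ [ext_map f (_ *: _)]linearZ.
rewrite [ext_map f _]linearZ [RHS]linearZ /=; congr (_ *: _).
rewrite wedge_delta ext_map_delta.
rewrite (wedge_family (fun i : 'I_(\dim {:U1}) => f (vbasis {:U1})`_i)).
by case: ifP => _; rewrite ?linear0 // linearZ /= ext_map_delta.
Qed.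

Lemma ext_map_seq (U1 U2 : vectType k) (f : {linear U1 -> U2}) s :
  ext_map f (wedge_seq s) = wedge_seq (map f s).
Proof.
elim: s => [|u s IHs] /=; last by rewrite ext_map_wedge IHs.
have -> : [ffun I => (I == set0)%:R] = ext_delta set0 :> exterior k U1 by [].
by rewrite ext_map_delta enum_set0.
Qed.

(** [ext_pow] is generated by increasing products of basis vectors only; the point is
    that wedging one more basis vector to such a product gives, up to sign, another
    one or zero. *)
Lemma wedge_seq_in_ext_pow (U : vectType k) (H : {vspace U}) s :
  {subset s <= H} -> wedge_seq s \in ext_pow H (size s).
Proof.
elim: s => [|u s IHs] sH /=.
  by apply: memv_span; apply/imageP; exists set0; rewrite ?inE ?cards0 //= enum_set0.
have uH : u \in H by apply: sH; rewrite mem_head.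
have /IHs {IHs sH} : {subset s <= H} by move=> v vs; apply: sH; rewrite inE vs orbT.
move: (wedge_seq s) (size s) => x j xj.
rewrite (coord_vbasis uH) wedge_suml; apply: memv_suml => i _.
rewrite wedgeZl memvZ //.
suffices: (linfun (wedge (vbasis H)`_i) @: ext_pow H j <= ext_pow H j.+1)%VS.
  by move/subvP; apply; apply/memv_imgP; exists x; rewrite ?lfunE.
rewrite limg_span; apply/span_subvP => _ /mapP[_ /imageP[J /[!inE] /eqP cJ ->] ->].
rewrite lfunE /= (wedge_family (fun i : 'I_(\dim H) => (vbasis H)`_i)).
case: ifP => [_|iJ]; first exact: mem0v.
apply: memvZ; apply: memv_span; apply/imageP; exists (i |: J) => //.
by rewrite inE cardsU1 iJ cJ.
Qed.

Lemma ext_pow_ind (U : vectType k) (H : {vspace U}) j (X : {vspace exterior k U}) :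
    (forall s, {subset s <= H} -> size s = j -> wedge_seq s \in X) ->
  (ext_pow H j <= X)%VS.
Proof.
move=> sX; apply/span_subvP => _ /imageP[J /[!inE] /eqP cJ ->]; apply: sX.
  by move=> _ /mapP[i _ ->]; rewrite vbasis_mem // mem_nth // size_tuple.
by rewrite size_map -cardE.
Qed.

End ExtMap.

(** * Tensor products of exterior algebras *)

Section Tensors.
Variables (k : fieldType) (U1 U2 : vectType k).
Implicit Types (x : exterior k U1) (y : exterior k U2) (t : exterior2 k U1 U2).

Fact tens_is_linear x : linear (@tens k U1 U2 x).
Proof. by move=> a y z; apply/ffunP => p; rewrite !ffunE mulrDr [_ * (a *: _)]mulrCA. Qed.

HB.instance Definition _ x :=
  GRing.isLinear.Build k (exterior k U2) (exterior2 k U1 U2) *:%R (tens x)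
    (tens_is_linear x).

Definition tensr y x := tens x y.

Fact tensr_is_linear y : linear (tensr y).
Proof. by move=> a x z; apply/ffunP => p; rewrite !ffunE mulrDl -mulrA. Qed.

HB.instance Definition _ y :=
  GRing.isLinear.Build k (exterior k U1) (exterior2 k U1 U2) *:%R (tensr y)
    (tensr_is_linear y).

Lemma mem_tensv (X : {vspace exterior k U1}) (Y : {vspace exterior k U2}) x y :
  x \in X -> y \in Y -> tens x y \in tensv X Y.
Proof.
move=> xX yY; rewrite (coord_vbasis yY) linear_sum memv_suml // => j _.
rewrite linearZ memvZ //= -/(tensr _ x) (coord_vbasis xX) linear_sum memv_suml // => i _.
rewrite linearZ memvZ //=; apply: memv_span; apply/allpairsP.
exists ((vbasis X)`_i, (vbasis Y)`_j).
by split; rewrite //= mem_nth // size_tuple.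
Qed.

Lemma tensv_sub (X : {vspace exterior k U1}) (Y : {vspace exterior k U2})
    (Z : {vspace exterior2 k U1 U2}) :
    (forall x y, x \in X -> y \in Y -> tens x y \in Z) ->
  (tensv X Y <= Z)%VS.
Proof.
move=> XYZ; apply/span_subvP => _ /allpairsP[[x y] /= [xX yY ->]].
by apply: XYZ; apply: vbasis_mem.
Qed.

(** A bilinear map is computed from its values on pairs of basis elements; both
    [tens_map] and [tens_cross] are defined by such sums. *)
Lemma bilinear_delta_sum (Z : lmodType k) (B : exterior k U1 -> exterior k U2 -> Z) x y :
    (forall y', linear (B^~ y')) -> (forall x', linear (B x')) ->
  \sum_p tens x y p *: B (ext_delta p.1) (ext_delta p.2) = B x y.
Proof.
move=> Bl Br.
pose Bl' y' : {linear exterior k U1 -> Z} :=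
  HB.pack (B^~ y') (GRing.isLinear.Build k _ _ _ (B^~ y') (Bl y')).
pose Br' x' : {linear exterior k U2 -> Z} :=
  HB.pack (B x') (GRing.isLinear.Build k _ _ _ (B x') (Br x')).
rewrite [in RHS](ext_sum_delta x) -[RHS]/(Bl' y _) linear_sum.
under [RHS]eq_bigr => I _ do
  rewrite linearZ /= [in B _ _](ext_sum_delta y) -[B _ _]/(Br' (ext_delta I) _) linear_sum.
under [RHS]eq_bigr => I _ do rewrite scaler_sumr.
rewrite pair_big /=; apply: eq_bigr => -[I J] _ /=.
by rewrite -[B _ _ in RHS]/(Br' _ _) linearZ scalerA ffunE.
Qed.

End Tensors.

(** The tensor product of [f] and [g] followed by the exchange of the two factors.
    There is no Koszul sign: the edge maps act on the factors without signs, so the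
    plain exchange intertwines them, with the same scalars on both sides. *)
Definition tens_cross (k : fieldType) (U1 U2 U1' U2' : vectType k)
    (f : exterior k U1 -> exterior k U1') (g : exterior k U2 -> exterior k U2')
    (t : exterior2 k U1 U2) : exterior2 k U2' U1' :=
  \sum_p t p *: tens (g (ext_delta p.2)) (f (ext_delta p.1)).

Section TensorMaps.
Variable k : fieldType.

Fact tens_cross_is_linear (U1 U2 U1' U2' : vectType k) f g :
  linear (@tens_cross k U1 U2 U1' U2' f g).
Proof.
move=> a x y; rewrite /tens_cross scaler_sumr -big_split; apply: eq_bigr => p _.
by rewrite !ffunE scalerDl scalerA.
Qed.

HB.instance Definition _ (U1 U2 U1' U2' : vectType k) f g :=
  GRing.isLinear.Build k (exterior2 k U1 U2) (exterior2 k U2' U1') *:%R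
    (@tens_cross k U1 U2 U1' U2' f g) (tens_cross_is_linear f g).

Lemma tens_map_tens (U1 U2 : vectType k)
    (f : {linear exterior k U1 -> exterior k U1})
    (g : {linear exterior k U2 -> exterior k U2}) x y :
  tens_map f g (tens x y) = tens (f x) (g y).
Proof.
apply: (bilinear_delta_sum (B := fun x y => tens (f x) (g y))) => z a u v /=.
  by rewrite linearP; apply: (tensr_is_linear (g z)).
by rewrite linearP tens_is_linear.
Qed.

Lemma tens_cross_tens (U1 U2 U1' U2' : vectType k)
    (f : {linear exterior k U1 -> exterior k U1'})
    (g : {linear exterior k U2 -> exterior k U2'}) x y :
  tens_cross f g (tens x y) = tens (g y) (f x).
Proof.
apply: (bilinear_delta_sum (B := fun x y => tens (g y) (f x))) => z a u v /=.
  by rewrite linearP tens_is_linear.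
by rewrite linearP; apply: (tensr_is_linear (f z)).
Qed.

End TensorMaps.

(** * Orthogonal projections *)

Section OrthogonalProjections.
Variables (k : fieldType) (V : vectType k) (b : {symmetric V}).
Implicit Types (U X : {vspace V}) (x y z : V).

Lemma sym_formC x y : b x y = b y x.
Proof. by rewrite hermC expr0 mul1r. Qed.

(** [orthov b U] is cut out by [\dim U] linear equations. *)
Lemma dim_orthov_ge U : (\dim {:V} <= \dim U + \dim (orthov b U))%N.
Proof.
suffices capP (l : seq V) (E : {vspace V}) :
    (\dim E <= size l + \dim (E :&: orthov b <<l>>))%N.
  by have := capP (vbasis U) fullv; rewrite size_tuple (span_basis (vbasisP U)) capfv.
elim: l E => [|u l IHl] E /=; first by rewrite span_nil orthov0 capvf.
have -> : orthov b <<u :: l>> = (orthov b <[u]> :&: orthov b <<l>>)%VS.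
  by apply/vspaceP => x; rewrite memv_cap !mem_orthov_sym span_cons subv_add.
rewrite capvA addSn -add1n.
apply: leq_trans (leq_add (leqnn 1%N) (IHl (E :&: orthov b <[u]>)%VS)); rewrite add1n.
by have := leq_dim_orthov1 b u E; case: (\dim E).
Qed.

Section Nondegenerate.
Variables (U : {vspace V}).
Hypothesis ndU : nondeg_on b U.

Lemma addv_orthov : (U + orthov b U = fullv)%VS.
Proof.
apply/eqP; rewrite eqEdim subvf /= dimv_disjoint_sum //; exact: dim_orthov_ge.
Qed.

Lemma memv_oproj x : oproj b U x \in U.
Proof. exact: memv_pi. Qed.

Lemma oproj_id x : x \in U -> oproj b U x = x.
Proof. exact: daddv_pi_id. Qed.

Lemma sub_oproj_orthov x : x - oproj b U x \in orthov b U.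
Proof.
have {1}<- : oproj b U x + daddv_pi (orthov b U) U x = x.
  by apply: daddv_pi_add => //; rewrite addv_orthov memvf.
by rewrite addrC addKr memv_pi.
Qed.

Lemma form_oproj x y : y \in U -> b (oproj b U x) y = b x y.
Proof.
move=> yU; have /mem_orthovP/(_ y yU) := sub_oproj_orthov x.
by rewrite linearBl => /eqP; rewrite subr_eq0 => /eqP.
Qed.

Lemma nondeg_eq0 x : x \in U -> x \in orthov b U -> x = 0.
Proof. by move=> xU xo; apply/eqP; rewrite -memv0 -ndU memv_cap xU xo. Qed.

Lemma oproj_orthov x : x \in orthov b U -> oproj b U x = 0.
Proof.
move=> xo; apply: nondeg_eq0; first exact: memv_oproj.
by rewrite -(subKr x (oproj b U x)) memvB // sub_oproj_orthov.
Qed.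

Lemma oproj_unique x y : y \in U -> x - y \in orthov b U -> oproj b U x = y.
Proof.
move=> yU xy; rewrite -[in LHS](subrK y x) linearD /= oproj_orthov // add0r.
exact: oproj_id.
Qed.

Lemma oproj_eq x y : x - y \in orthov b U -> oproj b U x = oproj b U y.
Proof. by move/oproj_orthov/eqP; rewrite linearB subr_eq0 => /eqP. Qed.

End Nondegenerate.

Lemma orthovS U X : (U <= X)%VS -> (orthov b X <= orthov b U)%VS.
Proof. by move=> UX; rewrite orthov_sym; apply: subv_trans UX _; rewrite orthov_sym. Qed.

Lemma oproj_sub U X x : nondeg_on b U -> nondeg_on b X -> (U <= X)%VS ->
  oproj b U (oproj b X x) = oproj b U x.
Proof.
move=> ndU ndX UX; apply/esym/oproj_eq => //.
exact: (subvP (orthovS UX)) (sub_oproj_orthov ndX x).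
Qed.

(** Nondegeneracy on [orthov b X] makes its orthogonal complement a complementary
    subspace, and [dim_orthov_ge] bounds the dimension of the latter by [\dim X]. *)
Lemma orthovK X : nondeg_on b (orthov b X) -> orthov b (orthov b X) = X.
Proof.
move=> ndo; apply/esym/eqP; rewrite eqEdim orthov_sym subvv /=.
rewrite -(leq_add2l (\dim (orthov b X))) -dimv_disjoint_sum // addv_orthov //.
by rewrite addnC dim_orthov_ge.
Qed.

(** The orthogonal complement of [U'] in [U] has dimension at most one, and it contains
    the projection of [c] to [U]. Two projections that differ by a multiple of this
    vector become equal after wedging with it. *)
Lemma hyperplane_oproj U U' c z :
    nondeg_on b U -> nondeg_on b U' ->
    (forall x, (x \in U') = (x \in U) && (b x c == 0)) -> z \in U ->
  z - oproj b U' z \in <[oproj b U c]>%VS.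
Proof.
move=> ndU ndU' U'E zU; set a := oproj b U c; set d := z - _.
have ba x : x \in U -> b x a = b x c.
  by move=> xU; rewrite sym_formC form_oproj // sym_formC.
have dU : d \in U.
  by rewrite memvB //; have := memv_oproj U' z; rewrite U'E => /andP[].
have aU : a \in U by apply: memv_oproj.
have dO : d \in orthov b U' by apply: sub_oproj_orthov.
have aO : a \in orthov b U'.
  by apply/mem_orthovP => x; rewrite U'E => /andP[xU /eqP bxc]; rewrite sym_formC ba.
have [baa0 | baa_neq0] := eqVneq (b a a) 0.
  (* [a] is isotropic only if it vanishes, and then [U' = U]. *)
  have a0 : a = 0 by apply: (nondeg_eq0 ndU') => //; rewrite U'E aU -ba ?baa0 /=.
  suffices -> : d = 0 by apply: mem0v.
  by apply: (nondeg_eq0 ndU') => //; rewrite U'E dU -ba // a0 linear0r eqxx.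
apply/vlineP; exists (b d a / b a a); apply/eqP; rewrite -subr_eq0; apply/eqP.
apply: (nondeg_eq0 ndU'); last by rewrite memvB ?memvZ.
have eU : d - (b d a / b a a) *: a \in U by rewrite memvB ?memvZ.
by rewrite U'E eU -ba //= linearBl linearZl_LR /= mulfVK ?subrr.
Qed.

End OrthogonalProjections.


(** * Subspaces attached to an arrangement *)

Lemma linfunE (k : fieldType) (U1 U2 : vectType k) (f : U1 -> U2) :
  linear f -> linfun f =1 f.
Proof.
move=> fP x; pose g : {linear U1 -> U2} := HB.pack f (GRing.isLinear.Build k _ _ _ f fP).
exact: (lfunE g).
Qed.

Section Arrangements.
Variables (k : fieldType) (n : nat) (A : signed_arrangement k n).
Local Notation V := (sa_space A).
Local Notation nu := (@sa_vec k n A).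
Local Notation Kn := 'rV[k]_n.
Local Notation dot := (@Defs.dotmx k n : {symmetric Kn}).
Implicit Types (S T : {set 'I_n}) (r : 'I_n).

Lemma dotmx_delta (w : Kn) r : Defs.dotmx w (delta_mx 0 r) = w 0 r.
Proof.
rewrite /Defs.dotmx (bigD1 r) //= !mxE !eqxx mulr1 big1 ?addr0 // => i nir.
by rewrite mxE eqxx (negbTE nir) mulr0.
Qed.

Definition sa_comb : 'Hom(Kn, V) := linfun (fun w : Kn => \sum_i w 0 i *: nu i).

Lemma sa_combE (w : Kn) : sa_comb w = \sum_i w 0 i *: nu i.
Proof.
rewrite linfunE // => a u v; rewrite scaler_sumr -big_split; apply: eq_bigr => i _.
by rewrite !mxE scalerDl scalerA.
Qed.

Lemma sa_comb_delta r : sa_comb (delta_mx 0 r) = nu r.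
Proof.
rewrite sa_combE (bigD1 r) //= mxE !eqxx scale1r big1 ?addr0 // => i nir.
by rewrite mxE eqxx (negbTE nir) scale0r.
Qed.

Lemma mem_sa_W (w : Kn) : (w \in sa_W A) = (sa_comb w == 0).
Proof. by rewrite memv_ker. Qed.

Lemma mem_sa_WS T (w : Kn) :
  reflect (w \in sa_W A /\ forall r, r \notin T -> w 0 r = 0) (w \in sa_WS A T).
Proof.
have coordE r : linfun (fun u : Kn => (u 0 r : k^o)) w = w 0 r.
  by rewrite linfunE // => a u v; rewrite !mxE.
rewrite memv_cap; apply: (iffP andP) => -[wW wT]; split=> //.
  move=> r rT; have := subvP (bigcapv_inf r rT (subvv _)) w wT.
  by rewrite memv_ker coordE => /eqP.
rewrite memvE; apply/subv_bigcapP => r rT.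
by rewrite -memvE memv_ker coordE wT.
Qed.

Lemma sa_H_orthov T : sa_H A T = orthov (sa_form A) (sa_V A T).
Proof.
apply/eqP; rewrite eqEsubv; apply/andP; split.
  rewrite orthov_sym; apply/subv_sumP => s sT; rewrite orthov_sym.
  exact: (bigcapv_inf s sT).
by apply/subv_bigcapP => s sT; apply: orthovS; apply: (sumv_sup s).
Qed.

Lemma mem_sa_V T r : r \in T -> nu r \in sa_V A T.
Proof. by move=> rT; rewrite memvE; apply: (sumv_sup r). Qed.

Lemma mem_sa_H T x :
  reflect (forall s, s \in T -> sa_form A x (nu s) = 0) (x \in sa_H A T).
Proof.
rewrite memvE; apply: (iffP subv_bigcapP) => xT s /xT.
  by rewrite -memvE mem_orthov1 => /eqP.
by move=> /eqP; rewrite -memvE mem_orthov1.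
Qed.

Lemma sa_H_sub T T' : T \subset T' -> (sa_H A T' <= sa_H A T)%VS.
Proof.
move=> TT'; apply/subvP => x /mem_sa_H xT'; apply/mem_sa_H => s sT.
by apply: xT'; apply: (subsetP TT').
Qed.

Lemma sa_WS_sub T T' : T \subset T' -> (sa_WS A T <= sa_WS A T')%VS.
Proof.
move=> TT'; apply/subvP => w /mem_sa_WS[wW wT]; apply/mem_sa_WS; split=> // r rT'.
by apply: wT; apply: contraNN rT'; apply: (subsetP TT').
Qed.

Lemma sa_WS_setT : sa_WS A setT = sa_W A.
Proof.
apply/vspaceP => w; apply/mem_sa_WS/idP => [[]//|wW]; split=> // r.
by rewrite inE.
Qed.

(** A relation [w] with [w 0 r != 0] would express [nu r] through the vectors of [T]. *)
Lemma sa_WS_coord0 T r w :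
  nu r \notin sa_V A T -> w \in sa_WS A (r |: T) -> w 0 r = 0.
Proof.
move=> nrV /mem_sa_WS[]; rewrite mem_sa_W sa_combE (bigD1 r) //= addr_eq0 => /eqP wr wT.
apply/eqP; apply: contraNT nrV => wr0.
rewrite -[nu r](scalerK wr0) wr memvZ // memvN memv_suml // => i nir.
have [iT|iT] := boolP (i \in T); first by rewrite memvZ ?mem_sa_V.
by rewrite wT ?scale0r ?mem0v // !inE negb_or nir.
Qed.

Lemma sa_V_relation T r : nu r \in sa_V A T ->
  exists2 w, w \in sa_W A & forall s, s \notin T -> w 0 s = (s == r)%:R.
Proof.
case/memv_sumP=> v vV nur.
have {vV} vV s : exists c, s \in T -> v s = c *: nu s.
  by have [/vV/vlineP[c ->]|_] := boolP (s \in T); [exists c | exists 0].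
have [c cE] := fin_all_exists vV.
exists (delta_mx 0 r - \row_s (if s \in T then c s else 0)); last first.
  by move=> s /negbTE sT; rewrite !mxE sT subr0 eqxx.
rewrite mem_sa_W linearB /= sa_comb_delta subr_eq0 nur sa_combE.
rewrite big_mkcond /=; apply/eqP; apply: eq_bigr => s _; rewrite mxE.
by case: ifP => [/cE|_]; rewrite ?scale0r.
Qed.

Lemma sa_tilde_setU1 S r : sa_tilde A (r |: S) =
  if r \in sa_pos A then r |: sa_tilde A S else sa_tilde A S :\ r.
Proof.
apply/setP => i; case: ifP => rp; rewrite !inE; case: eqVneq => [->|] //=.
  by rewrite rp.
by rewrite rp.
Qed.

Lemma mem_sa_tilde S r : r \notin S -> (r \in sa_tilde A S) = (r \notin sa_pos A).
Proof. by move=> /negbTE rS; rewrite !inE rS. Qed.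

(** * Decomposable elements of the complex *)

Lemma mem_T_bipart S s1 s2 :
    {subset s1 <= sa_H A (sa_tilde A S)} -> {subset s2 <= sa_WS A (sa_tilde A S)} ->
  tens (wedge_seq s1) (wedge_seq s2) \in T_bipart A S (size s1) (size s2).
Proof. by move=> s1H s2W; apply: mem_tensv; apply: wedge_seq_in_ext_pow. Qed.

Lemma ext_pow_eq0 (U : vectType k) (H : {vspace U}) j :
  (\dim H < j)%N -> ext_pow H j = 0%VS.
Proof.
move=> ltHj; apply/eqP; rewrite -subv0; apply/span_subvP => _ /imageP[J /[!inE] /eqP cJ ->].
by have := max_card J; rewrite card_ord cJ leqNgt ltHj.
Qed.

(** Products with more factors than the dimension vanish, so the bounds in the sum
    defining [T_S] exclude nothing. *)
Lemma mem_T_S S s1 s2 :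
    {subset s1 <= sa_H A (sa_tilde A S)} -> {subset s2 <= sa_WS A (sa_tilde A S)} ->
  tens (wedge_seq s1) (wedge_seq s2) \in T_S A S.
Proof.
move=> s1H s2W.
have [lt1|le1] := ltnP (\dim (sa_H A (sa_tilde A S))) (size s1).
  have /eqP-> : wedge_seq s1 == 0.
    by rewrite -memv0 -(ext_pow_eq0 lt1) wedge_seq_in_ext_pow.
  by rewrite -/(tensr _ _) linear0 mem0v.
have [lt2|le2] := ltnP (\dim (sa_WS A (sa_tilde A S))) (size s2).
  have /eqP-> : wedge_seq s2 == 0.
    by rewrite -memv0 -(ext_pow_eq0 lt2) wedge_seq_in_ext_pow.
  by rewrite linear0 mem0v.
rewrite -ltnS in le1; rewrite -ltnS in le2.
rewrite memvE; apply: (sumv_sup (Ordinal le1)) => //.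
by apply: (sumv_sup (Ordinal le2)) => //; rewrite -memvE mem_T_bipart.
Qed.

Lemma T_bipart_ind S i j (Z : {vspace exterior2 k V Kn}) :
    (forall s1 s2, {subset s1 <= sa_H A (sa_tilde A S)} ->
       {subset s2 <= sa_WS A (sa_tilde A S)} -> size s1 = i -> size s2 = j ->
       tens (wedge_seq s1) (wedge_seq s2) \in Z) ->
  (T_bipart A S i j <= Z)%VS.
Proof.
move=> sZ; apply: tensv_sub => x y xH yW.
have tensrE z : linfun (tensr y) z = tens z y by rewrite lfunE.
have tensE z w : linfun (@tens k V Kn z) w = tens z w by rewrite lfunE.
rewrite -tensrE memv_preim; apply: (subvP _ x xH); apply: ext_pow_ind => s1 s1H c1.
rewrite -memv_preim tensrE -tensE memv_preim; apply: (subvP _ y yW).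
by apply: ext_pow_ind => s2 s2W c2; rewrite -memv_preim tensE sZ.
Qed.

Lemma T_S_ind S (Z : {vspace exterior2 k V Kn}) :
    (forall s1 s2, {subset s1 <= sa_H A (sa_tilde A S)} ->
       {subset s2 <= sa_WS A (sa_tilde A S)} ->
       tens (wedge_seq s1) (wedge_seq s2) \in Z) ->
  (T_S A S <= Z)%VS.
Proof.
move=> sZ; apply/subv_sumP => i _; apply/subv_sumP => j _.
by apply: T_bipart_ind => s1 s2 s1H s2W _ _; apply: sZ.
Qed.

(** This reduces identities between maps on the complex to identities between maps on
    vectors. *)
Lemma T_S_eq S (E : vectType k) (f g : {linear exterior2 k V Kn -> E}) :
    (forall s1 s2, {subset s1 <= sa_H A (sa_tilde A S)} ->
       {subset s2 <= sa_WS A (sa_tilde A S)} ->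
       f (tens (wedge_seq s1) (wedge_seq s2)) = g (tens (wedge_seq s1) (wedge_seq s2))) ->
  {in T_S A S, f =1 g}.
Proof.
move=> fg t tS; rewrite -(lfunE f) -(lfunE g); apply/eqlfunP; apply: (subvP _ t tS).
apply: T_S_ind => s1 s2 s1H s2W; apply/eqlfunP; rewrite !lfunE; exact: fg.
Qed.

Lemma T_S_sub S (E : vectType k) (f : {linear exterior2 k V Kn -> E}) (Z : {vspace E}) :
    (forall s1 s2, {subset s1 <= sa_H A (sa_tilde A S)} ->
       {subset s2 <= sa_WS A (sa_tilde A S)} ->
       f (tens (wedge_seq s1) (wedge_seq s2)) \in Z) ->
  {in T_S A S, forall t, f t \in Z}.
Proof.
move=> fZ t tS; rewrite -(lfunE f) memv_preim; apply: (subvP _ t tS).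
by apply: T_S_ind => s1 s2 s1H s2W; rewrite -memv_preim lfunE fZ.
Qed.

Lemma edge_map_decomposable S r s1 s2 :
  edge_map (A := A) S r (tens (wedge_seq s1) (wedge_seq s2)) =
  if r \in sa_pos A then
    let B := r |: sa_tilde A S in
    let s1' := [seq oproj (sa_form A) (sa_H A B) v | v <- s1] in
    if nu r \notin sa_V A (sa_tilde A S) then tens (wedge_seq s1') (wedge_seq s2)
    else tens (wedge_seq s1') (wedge_seq (oproj dot (sa_WS A B) (sa_covec A r) :: s2))
  else
    let B := sa_tilde A S :\ r in
    let s2' := [seq oproj dot (sa_WS A B) w | w <- s2] in
    if nu r \in sa_V A B then tens (wedge_seq s1) (wedge_seq s2')
    else tens (wedge_seq (oproj (sa_form A) (sa_H A B) (nu r) :: s1)) (wedge_seq s2').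
Proof.
rewrite /edge_map; case: ifP => _ /=; case: ifP => _.
- by rewrite (tens_map_tens (ext_map _) idfun) /= ext_map_seq.
- by rewrite (tens_map_tens (ext_map _) (wedge _)) /= ext_map_seq.
- by rewrite (tens_map_tens idfun (ext_map _)) /= ext_map_seq.
- by rewrite (tens_map_tens (wedge _) (ext_map _)) /= ext_map_seq.
Qed.

Lemma edge_map_T_S S r : r \notin S ->
  {in T_S A S, forall t, edge_map (A := A) S r t \in T_S A (r |: S)}.
Proof.
move=> rS; apply: T_S_sub => s1 s2 s1H s2W /=; rewrite edge_map_decomposable.
have := sa_tilde_setU1 S r; case: ifP => rp /= tE.
  have s1H' : {subset [seq oproj (sa_form A) (sa_H A (r |: sa_tilde A S)) v | v <- s1]
               <= sa_H A (sa_tilde A (r |: S))}.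
    by rewrite tE => _ /mapP[v _ ->]; apply: memv_oproj.
  have s2W' : {subset s2 <= sa_WS A (sa_tilde A (r |: S))}.
    by rewrite tE => w /s2W; apply: (subvP (sa_WS_sub (subsetUr _ _))).
  case: ifP => _; first exact: mem_T_S.
  apply: (mem_T_S (s2 := _ :: s2)) => // w; rewrite inE => /orP[/eqP->|/s2W' //].
  by rewrite tE memv_oproj.
have s2W' : {subset [seq oproj dot (sa_WS A (sa_tilde A S :\ r)) v | v <- s2]
             <= sa_WS A (sa_tilde A (r |: S))}.
  by rewrite tE => _ /mapP[v _ ->]; apply: memv_oproj.
have s1H' : {subset s1 <= sa_H A (sa_tilde A (r |: S))}.
  by rewrite tE => w /s1H; apply: (subvP (sa_H_sub (subsetDl _ _))).
case: ifP => _; first exact: mem_T_S.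
apply: (mem_T_S (s1 := _ :: s1)) => // w; rewrite inE => /orP[/eqP->|/s1H' //].
by rewrite tE memv_oproj.
Qed.

End Arrangements.

(** * The Gale dual arrangement *)

Section GaleDual.
Variables (k : fieldType) (n : nat) (A : signed_arrangement k n).
Local Notation V := (sa_space A).
Local Notation nu := (@sa_vec k n A).
Local Notation Kn := 'rV[k]_n.
Local Notation dot := (@Defs.dotmx k n : {symmetric Kn}).
Local Notation W := (sa_W A).
Local Notation A' := (gale_dual A).
Local Notation e_ r := (delta_mx 0 r : Kn).
Implicit Types (S T : {set 'I_n}) (r : 'I_n) (w u : Kn) (v : V).

Hypothesis A_spanning : spanning A.
Hypothesis A_nondeg : nondegenerate_arrangement A.
Hypothesis A_dual_nondeg : nondegenerate_arrangement A'.

Let ndH T : nondeg_on (sa_form A) (sa_H A T). Proof. exact: A_nondeg.1. Qed.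
Let ndWS T : nondeg_on dot (sa_WS A T). Proof. exact: A_nondeg.2. Qed.
Let ndH' T : nondeg_on (sa_form A') (sa_H A' T). Proof. exact: A_dual_nondeg.1. Qed.
Let ndWS' T : nondeg_on dot (sa_WS A' T). Proof. exact: A_dual_nondeg.2. Qed.
Let ndW : nondeg_on dot W. Proof. by rewrite -sa_WS_setT. Qed.

Lemma sa_tilde_dual S : sa_tilde A' S = ~: sa_tilde A S.
Proof. by apply/setP => i; rewrite !inE; case: (i \in S); case: (i \in sa_pos A). Qed.

Lemma dot_coord w r : dot w (e_ r) = w 0 r.
Proof. exact: dotmx_delta. Qed.

(** The dual vectors represent the coordinate functionals of [W]. *)
Lemma form_dual_vec (w : subvs_of W) r :
  sa_form A' w (sa_vec A' r) = (vsval w) 0 r.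
Proof.
rewrite /= /sub_form vsprojK ?memv_oproj // sym_formC form_oproj ?subvsP //.
by rewrite sym_formC dot_coord.
Qed.

Lemma mem_dual_H T (w : subvs_of W) :
  (w \in sa_H A' (~: T)) = (vsval w \in sa_WS A T).
Proof.
apply/mem_sa_H/mem_sa_WS => [wT|[_ wT] r].
  split=> [|r rT]; first exact: subvsP.
  by rewrite -form_dual_vec wT // inE.
by rewrite inE form_dual_vec => /wT.
Qed.

(** The quotient of [k^n] by this subspace is [V] modulo the span of the [nu s] for
    [s \in T]; it is the common model through which [sa_H A T] and the dual
    [sa_WS A' (~: T)] are compared. *)
Definition dual_ann T : {vspace Kn} := (W + \sum_(s in T) <[e_ s]>)%VS.

Lemma dual_WS_orthov T : sa_WS A' (~: T) = orthov dot (dual_ann T).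
Proof.
apply/vspaceP => u.
have combE : sa_comb A' u = vsproj W (oproj dot W u).
  rewrite sa_combE {2}(row_sum_delta u) !linear_sum.
  by apply: eq_bigr => i _; rewrite !linearZ.
have uW : (u \in sa_W A') = (u \in orthov dot W).
  rewrite mem_sa_W combE; apply/eqP/idP => [p0|/(oproj_orthov ndW)->]; last exact: linear0.
  have op0 : oproj dot W u = 0 by rewrite -[LHS](vsprojK (memv_oproj _ _ _)) p0.
  by have := sub_oproj_orthov ndW u; rewrite op0 subr0.
rewrite mem_orthov_sym subv_add -mem_orthov_sym -uW.
apply/mem_sa_WS/andP => -[-> uT]; split=> //.
  apply/subv_sumP => s sT; rewrite -mem_orthov_sym mem_orthov1 dot_coord uT ?eqxx //.
  by rewrite inE negbK.
move=> r; rewrite inE negbK => rT; move/subv_sumP: uT => /(_ r rT).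
by rewrite -mem_orthov_sym mem_orthov1 dot_coord => /eqP.
Qed.

Lemma orthov_dual_WS T : orthov dot (sa_WS A' (~: T)) = dual_ann T.
Proof. by rewrite dual_WS_orthov orthovK // -dual_WS_orthov. Qed.

Lemma orthov_H T : orthov (sa_form A) (sa_H A T) = sa_V A T.
Proof. by rewrite sa_H_orthov orthovK // -sa_H_orthov. Qed.

Lemma sa_comb_ann T w : w \in dual_ann T -> sa_comb A w \in sa_V A T.
Proof.
move=> wT; suffices: (dual_ann T <= sa_comb A @^-1: sa_V A T)%VS.
  by move/subvP/(_ w wT); rewrite -memv_preim.
rewrite subv_add; apply/andP; split.
  by apply/subvP => u; rewrite mem_sa_W -memv_preim => /eqP->; apply: mem0v.
apply/subv_sumP => s sT; rewrite -memvE -memv_preim sa_comb_delta; exact: mem_sa_V.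
Qed.

Lemma limg_sa_comb : limg (sa_comb A) = fullv.
Proof.
apply/eqP; rewrite eqEsubv subvf -A_spanning; apply/subv_sumP => s _.
by rewrite -memvE -sa_comb_delta memv_img ?memvf.
Qed.

(** Lifts of the same vector differ by an element of [W], so the choice of the section
    is irrelevant after projection to any [sa_WS A' T]. *)
Definition sa_lift : 'Hom(V, Kn) := (sa_comb A)^-1%VF.

Lemma sa_liftK v : sa_comb A (sa_lift v) = v.
Proof. by rewrite limg_lfunVK // limg_sa_comb memvf. Qed.

Lemma sa_lift_ann T v w : sa_comb A w - v \in sa_V A T -> w - sa_lift v \in dual_ann T.
Proof.
case/memv_sumP=> x xT E.
have {xT} xT s : exists c, s \in T -> x s = c *: nu s.
  by have [/xT/vlineP[c ->]|_] := boolP (s \in T); [exists c | exists 0].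
have [c cE] := fin_all_exists xT.
pose w' := \sum_(s in T) c s *: e_ s.
rewrite -(subrK w' (_ - _)); apply: memv_add.
  rewrite mem_sa_W !linearB /= sa_liftK E linear_sum subr_eq0; apply/eqP.
  by apply: eq_bigr => s sT; rewrite linearZ /= sa_comb_delta cE.
by apply: memv_sumr => s sT; rewrite memvZ ?memv_line.
Qed.

(** Both [sa_H A T] and [sa_WS A' (~: T)] are orthogonal complements, in [V] and in
    [k^n], of corresponding subspaces, hence models of the same quotient; [gale_H] is
    the resulting identification. It is not induced by a single isometry of [V] with
    the orthogonal complement of [W], since the two inner products are unrelated; this
    is why it depends on [T]. *)
Definition gale_H T : 'Hom(V, Kn) := (oproj dot (sa_WS A' (~: T)) \o sa_lift)%VF.
Definition gale_H_inv T : 'Hom(Kn, V) :=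
  (oproj (sa_form A) (sa_H A T) \o sa_comb A)%VF.

Lemma gale_HE T v : gale_H T v = oproj dot (sa_WS A' (~: T)) (sa_lift v).
Proof. exact: comp_lfunE. Qed.

Lemma gale_H_invE T w :
  gale_H_inv T w = oproj (sa_form A) (sa_H A T) (sa_comb A w).
Proof. exact: comp_lfunE. Qed.

Lemma gale_H_comb T v w :
  sa_comb A w - v \in sa_V A T -> gale_H T v = oproj dot (sa_WS A' (~: T)) w.
Proof.
by move=> /sa_lift_ann wv; rewrite gale_HE; apply/esym/oproj_eq; rewrite ?orthov_dual_WS.
Qed.

Lemma gale_HK T : {in sa_H A T, cancel (gale_H T) (gale_H_inv T)}.
Proof.
move=> v vH; rewrite gale_H_invE; apply: oproj_unique => //.
rewrite orthov_H -[X in _ - X]sa_liftK -linearB; apply: sa_comb_ann.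
by rewrite -orthov_dual_WS gale_HE -opprB memvN sub_oproj_orthov.
Qed.

Lemma gale_H_invK T : {in sa_WS A' (~: T), cancel (gale_H_inv T) (gale_H T)}.
Proof.
move=> u uW; rewrite (gale_H_comb (w := u)); first exact: oproj_id.
by rewrite gale_H_invE -orthov_H sub_oproj_orthov.
Qed.

Lemma mem_gale_H T v : gale_H T v \in sa_WS A' (~: T).
Proof. by rewrite gale_HE memv_oproj. Qed.

Lemma mem_gale_H_inv T w : gale_H_inv T w \in sa_H A T.
Proof. by rewrite gale_H_invE memv_oproj. Qed.

Lemma dual_WS_sub T T' : T \subset T' -> (sa_WS A' (~: T') <= sa_WS A' (~: T))%VS.
Proof. by move=> TT'; apply: sa_WS_sub; rewrite setCS. Qed.

Lemma gale_H_sub T T' v : T \subset T' ->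
  oproj dot (sa_WS A' (~: T')) (gale_H T v) = gale_H T' v.
Proof. by move=> TT'; rewrite !gale_HE oproj_sub // dual_WS_sub. Qed.

Lemma gale_H_oproj T v : gale_H T (oproj (sa_form A) (sa_H A T) v) = gale_H T v.
Proof.
rewrite [RHS]gale_HE; apply: gale_H_comb.
by rewrite sa_liftK -orthov_H sub_oproj_orthov.
Qed.

Lemma gale_H_vec T r : gale_H T (nu r) = oproj dot (sa_WS A' (~: T)) (e_ r).
Proof. by apply: gale_H_comb; rewrite sa_comb_delta subrr mem0v. Qed.

Lemma oproj_dual_covec T r :
  oproj dot (sa_WS A' T) (sa_covec A' r) = oproj dot (sa_WS A' T) (e_ r).
Proof.
apply: oproj_sub => //; rewrite -?(sa_WS_setT A') //; exact: sa_WS_sub (subsetT _).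
Qed.

(** A relation expressing [nu r] through the vectors of [T] is orthogonal to the dual
    relations, so the vanishing of their coordinates in [T] forces that of the
    coordinate [r]. *)
Lemma dual_WS_setU1_eq T r : nu r \in sa_V A T ->
  sa_WS A' (~: (r |: T)) = sa_WS A' (~: T).
Proof.
move=> nuT; apply/vspaceP => u; apply/idP/idP; first exact/subvP/dual_WS_sub/subsetUr.
move=> uT; have [w wW wT] := sa_V_relation nuT.
have := uT; rewrite dual_WS_orthov => /mem_orthovP uO.
case/mem_sa_WS: (uT) => uW u0; apply/mem_sa_WS; split=> // s; rewrite inE negbK !inE.
have u0' t : t \in T -> u 0 t = 0 by move=> tT; apply: u0; rewrite inE negbK.
case/orP=> [/eqP->{s}|/u0'//].
have [/u0'//|rT] := boolP (r \in T).
have <- : dot u w = u 0 r.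
  rewrite /= /Defs.dotmx (bigD1 r) //= wT // eqxx mulr1 big1 ?addr0 // => s nsr.
  have [/u0'->|/wT->] := boolP (s \in T); first by rewrite mul0r.
  by rewrite (negbTE nsr) mulr0.
by apply: uO; apply: subvP (addvSl _ _) w wW.
Qed.

Lemma vsproj_oproj T w : w \in W ->
  vsproj W (oproj dot (sa_WS A T) w) = oproj (sa_form A') (sa_H A' (~: T)) (vsproj W w).
Proof.
have WSW : (sa_WS A T <= W)%VS by rewrite -sa_WS_setT sa_WS_sub ?subsetT.
have pW : oproj dot (sa_WS A T) w \in W by apply: (subvP WSW); apply: memv_oproj.
move=> wW; apply/esym/oproj_unique => //; first by rewrite mem_dual_H vsprojK // memv_oproj.
apply/mem_orthovP => x; rewrite mem_dual_H => xT.
rewrite /= /sub_form /= !vsprojK //.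
by have /mem_orthovP -> := sub_oproj_orthov (ndWS T) w.
Qed.

(** Duality of matroids: [nu r] depends on the vectors of [T] exactly when some
    relation supported in [r |: T] has a nonzero coordinate at [r], that is, when the
    dual vector of [r] is not orthogonal to [sa_WS A (r |: T)]. *)
Lemma dual_vec_in_V T r : r \notin T ->
  (sa_vec A' r \in sa_V A' (~: (r |: T))) = (nu r \notin sa_V A T).
Proof.
move=> rT.
have <- : orthov (sa_form A') (sa_H A' (~: (r |: T))) = sa_V A' (~: (r |: T)).
  by rewrite sa_H_orthov orthovK // -sa_H_orthov.
apply/mem_orthovP/idP => [orth|nuT w].
  apply/negP => /sa_V_relation[w wW wT].
  have wrT : w \in sa_WS A (r |: T).
    apply/mem_sa_WS; split=> // s; rewrite !inE negb_or => /andP[nsr sT].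
    by rewrite wT // (negbTE nsr).
  have := orth (vsproj W w); rewrite mem_dual_H vsprojK // => /(_ wrT) /eqP.
  by rewrite sym_formC form_dual_vec vsprojK // wT // eqxx oner_eq0.
rewrite mem_dual_H => wrT; rewrite sym_formC form_dual_vec; exact: sa_WS_coord0 wrT.
Qed.

(** * The isomorphism of complexes *)

Local Notation EA := (exterior2 k V Kn).
Local Notation EA' := (exterior2 k (subvs_of W) Kn).

Definition gale_T S : EA -> EA' :=
  tens_cross (ext_map (gale_H (sa_tilde A S))) (ext_map (vsproj W)).
Definition gale_T_inv S : EA' -> EA :=
  tens_cross (ext_map vsval) (ext_map (gale_H_inv (sa_tilde A S))).

HB.instance Definition _ S := GRing.Linear.on (gale_T S).
HB.instance Definition _ S := GRing.Linear.on (gale_T_inv S).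

Lemma gale_T_decomposable S s1 s2 :
  gale_T S (tens (wedge_seq s1) (wedge_seq s2)) =
  tens (wedge_seq (map (vsproj W) s2)) (wedge_seq (map (gale_H (sa_tilde A S)) s1)).
Proof. by rewrite /gale_T (tens_cross_tens (ext_map _) (ext_map _)) /= !ext_map_seq. Qed.

Lemma gale_T_inv_decomposable S s1 s2 :
  gale_T_inv S (tens (wedge_seq s1) (wedge_seq s2)) =
  tens (wedge_seq (map (gale_H_inv (sa_tilde A S)) s2)) (wedge_seq (map vsval s1)).
Proof. by rewrite /gale_T_inv (tens_cross_tens (ext_map _) (ext_map _)) /= !ext_map_seq. Qed.

Let WS_W T w : w \in sa_WS A T -> w \in W.
Proof. by case/mem_sa_WS. Qed.

Lemma gale_T_bipart S i j :
  {in T_bipart A S i j, forall t, gale_T S t \in T_bipart A' S j i}.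
Proof.
move=> t tS; rewrite -(lfunE (gale_T S)) memv_preim; apply: (subvP _ t tS).
apply: T_bipart_ind => s1 s2 s1H s2W <- <-.
rewrite -memv_preim lfunE /= gale_T_decomposable.
rewrite -(size_map (vsproj W) s2) -(size_map (gale_H (sa_tilde A S)) s1).
apply: (@mem_T_bipart k n A' S (map _ _) (map _ _)) => _ /mapP[v vs ->];
  rewrite sa_tilde_dual; last exact: mem_gale_H.
by rewrite mem_dual_H vsprojK ?s2W //; apply: WS_W (s2W v vs).
Qed.

Lemma gale_T_inv_bipart S i j :
  {in T_bipart A' S i j, forall t, gale_T_inv S t \in T_bipart A S j i}.
Proof.
move=> t tS; rewrite -(lfunE (gale_T_inv S)) memv_preim; apply: (subvP _ t tS).
apply: T_bipart_ind => s1 s2 s1H s2W <- <-.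
rewrite -memv_preim lfunE /= gale_T_inv_decomposable.
rewrite -(size_map vsval s1) -(size_map (gale_H_inv (sa_tilde A S)) s2).
apply: mem_T_bipart => _ /mapP[v vs ->]; first exact: mem_gale_H_inv.
by have := s1H v vs; rewrite sa_tilde_dual mem_dual_H.
Qed.

Lemma gale_TK S : {in T_S A S, cancel (gale_T S) (gale_T_inv S)}.
Proof.
move=> t tS; apply: (T_S_eq (f := gale_T_inv S \o gale_T S) (g := idfun) _ tS).
move=> s1 s2 s1H s2W /=.
rewrite gale_T_decomposable gale_T_inv_decomposable -!map_comp.
congr (tens (wedge_seq _) (wedge_seq _)); apply: map_id_in => v vs /=.
  exact/gale_HK/s1H.
by apply: vsprojK; apply: WS_W (s2W v vs).
Qed.

Lemma gale_T_invK S : {in T_S A' S, cancel (gale_T_inv S) (gale_T S)}.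
Proof.
move=> t tS; apply: (T_S_eq (A := A') (f := gale_T S \o gale_T_inv S) (g := idfun) _ tS).
move=> s1 s2 s1H s2W /=.
rewrite gale_T_inv_decomposable gale_T_decomposable -!map_comp.
congr (tens (wedge_seq _) (wedge_seq _)); apply: map_id_in => v vs /=.
  exact: vsvalK.
by apply: gale_H_invK; have := s2W v vs; rewrite sa_tilde_dual.
Qed.

Lemma dim_eq_cancel (E E' : vectType k) (X : {vspace E}) (Y : {vspace E'})
    (f : 'Hom(E, E')) (g : 'Hom(E', E)) :
    {in X, forall x, f x \in Y} -> {in Y, forall y, g y \in X} ->
    {in X, cancel f g} -> {in Y, cancel g f} ->
  \dim X = \dim Y.
Proof.
move=> fX gY fK gK.
have -> : Y = (f @: X)%VS.
  apply/eqP; rewrite eqEsubv; apply/andP; split; apply/subvP => y.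
    by move=> yY; apply/memv_imgP; exists (g y); rewrite ?gK ?gY.
  by case/memv_imgP=> x xX ->; apply: fX.
symmetry; apply: limg_dim_eq; apply/eqP; rewrite -subv0; apply/subvP => x.
rewrite memv_cap memv_ker memv0 => /andP[xX /eqP fx].
by rewrite -(fK x xX) fx linear0.
Qed.

Lemma dim_dual_WS T : \dim (sa_WS A' (~: T)) = \dim (sa_H A T).
Proof.
apply: (dim_eq_cancel (f := gale_H_inv T) (g := gale_H T)).
- by move=> u _; apply: mem_gale_H_inv.
- by move=> v _; apply: mem_gale_H.
- exact: gale_H_invK.
- exact: gale_HK.
Qed.

Lemma dim_dual_H T : \dim (sa_H A' (~: T)) = \dim (sa_WS A T).
Proof.
apply: (dim_eq_cancel (f := linfun vsval) (g := linfun (vsproj W))).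
- by move=> x; rewrite lfunE /= mem_dual_H.
- by move=> w wT; rewrite lfunE /= mem_dual_H vsprojK ?(WS_W wT).
- by move=> x _; rewrite !lfunE /= vsvalK.
- by move=> w wT; rewrite !lfunE /= vsprojK // (WS_W wT).
Qed.

Lemma mem_dual_WS_setU1 T r u :
  (u \in sa_WS A' (~: (r |: T))) = (u \in sa_WS A' (~: T)) && (dot u (e_ r) == 0).
Proof.
rewrite dot_coord; apply/mem_sa_WS/andP => [[uW u0]|[/mem_sa_WS[uW u0] /eqP ur]].
  split; last by apply/eqP/u0; rewrite inE negbK setU11.
  apply/mem_sa_WS; split=> // s; rewrite inE negbK => sT.
  by apply: u0; rewrite inE negbK setU1r.
split=> // s; rewrite inE negbK => /setU1P[->//|sT].
by apply: u0; rewrite inE negbK.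
Qed.

(** Duality exchanges positive with negative indices and, by [dual_vec_in_V],
    dependent with independent ones, so the first of the four kinds of edges
    corresponds to the third and the second to the fourth. *)
Lemma gale_T_edge S r : r \notin S ->
  {in T_S A S, forall t,
     gale_T (r |: S) (edge_map (A := A) S r t) = edge_map (A := A') S r (gale_T S t)}.
Proof.
move=> rS; apply: (T_S_eq (f := gale_T (r |: S) \o edge_map (A := A) S r)
                          (g := edge_map (A := A') S r \o gale_T S)) => s1 s2 s1H s2W /=.
have posE : (r \in sa_pos A') = (r \notin sa_pos A) by rewrite inE.
rewrite gale_T_decomposable !edge_map_decomposable posE sa_tilde_dual.
have rT := mem_sa_tilde A rS; have := sa_tilde_setU1 A S r.
case: ifP rT => rp rT tE.
  have {}rT : r \notin sa_tilde A S by rewrite rT.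
  change (~~ true) with false; cbv zeta iota.
  have -> : ~: sa_tilde A S :\ r = ~: (r |: sa_tilde A S).
    by rewrite setDE setCU setIC.
  rewrite dual_vec_in_V //; case: ifP => _;
    rewrite gale_T_decomposable tE; congr (tens (wedge_seq _) (wedge_seq _)).
  - by rewrite -!map_comp; apply: eq_map => v /=; rewrite gale_H_oproj gale_H_sub ?subsetUr.
  - by rewrite /= vsproj_oproj // memv_oproj.
  by rewrite -!map_comp; apply: eq_map => v /=; rewrite gale_H_oproj gale_H_sub ?subsetUr.
change (~~ false) with true; cbv zeta iota.
set T := sa_tilde A S in s1H s2W rT tE *; set T' := T :\ r in tE *.
have TE : T = r |: T' by rewrite setD1K ?rT.
have -> : r |: ~: T = ~: T' by rewrite setCD setUC.
have -> : (sa_vec A' r \notin sa_V A' (~: T)) = (nu r \in sa_V A T').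
  by rewrite TE dual_vec_in_V ?negbK // !inE eqxx.
have projW : map (vsproj W) (map (oproj dot (sa_WS A T')) s2) =
    map (oproj (sa_form A') (sa_H A' (~: T'))) (map (vsproj W) s2).
  rewrite -!map_comp; apply/eq_in_map => w /s2W wT /=.
  by rewrite vsproj_oproj // (WS_W wT).
case: ifP => nuT; rewrite gale_T_decomposable tE projW; congr (tens _ _).
  congr (wedge_seq _); apply: eq_map => v.
  by rewrite !gale_HE TE dual_WS_setU1_eq.
rewrite [map _ (_ :: _)]/= gale_H_oproj gale_H_vec oproj_dual_covec.
(* Enlarging the subspace from [sa_WS A' (~: T)] to [sa_WS A' (~: T')] changes the
   projection of [v] by a multiple of the vector that is wedged on the left. *)
apply: wedge_seq_modl => v _.
have sT'T : T' \subset T by apply: subsetDl.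
rewrite -(gale_H_sub v sT'T); apply: hyperplane_oproj => //; last exact: mem_gale_H.
by move=> u; rewrite TE mem_dual_WS_setU1.
Qed.

Definition gale_iso : 'Hom({ffun {set 'I_n} -> EA}, {ffun {set 'I_n} -> EA'}) :=
  linfun (fun t : {ffun {set 'I_n} -> EA} => [ffun S => gale_T S (t S)]).

Lemma gale_isoE t S : gale_iso t S = gale_T S (t S).
Proof.
rewrite linfunE ?ffunE // => a x y; apply/ffunP => S'.
by rewrite !ffunE linearP.
Qed.

Lemma mem_T_in (B : signed_arrangement k n)
    (P : {set 'I_n} -> {vspace exterior2 k (sa_space B) Kn})
    (t : {ffun {set 'I_n} -> exterior2 k (sa_space B) Kn}) :
  reflect (forall S, t S \in P S) (t \in T_in (A := B) P).
Proof.
have evalE S : linfun (ffun_eval (A := B) S) t = t S by rewrite lfunE.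
rewrite memvE; apply: (iffP subv_bigcapP) => tP S => [|_].
  by rewrite -evalE memv_preim memvE tP.
by rewrite -memvE -memv_preim evalE.
Qed.

Lemma limg_gale_iso (P : {set 'I_n} -> {vspace EA}) (P' : {set 'I_n} -> {vspace EA'}) :
    (forall S, {in P S, forall t, gale_T S t \in P' S}) ->
    (forall S, {in P' S, forall t, gale_T_inv S t \in P S}) ->
    (forall S, P' S <= T_S A' S)%VS ->
  (gale_iso @: T_in (A := A) P = T_in (A := A') P')%VS.
Proof.
move=> PP' P'P P'T; apply/vspaceP => t'.
apply/memv_imgP/(@mem_T_in A' P' t') => [[t /(@mem_T_in A P t) tP ->] S|tP'].
  by rewrite gale_isoE; apply: PP'; apply: tP.
exists [ffun S => gale_T_inv S (t' S)].
  by apply/(@mem_T_in A P) => S; rewrite ffunE; apply/P'P/tP'.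
apply/ffunP => S; rewrite gale_isoE ffunE gale_T_invK //.
exact/(subvP (P'T S))/tP'.
Qed.

(** [P] is a condition on the bidegree; it is constantly true for [T_S], and selects
    one bihomogeneous part for [T_piece]. *)
Lemma gale_T_sum S (P : nat -> nat -> bool) :
  {in (\sum_(i < (\dim (sa_H A (sa_tilde A S))).+1)
         \sum_(j < (\dim (sa_WS A (sa_tilde A S))).+1 | P i j) T_bipart A S i j)%VS,
   forall t, gale_T S t \in
     (\sum_(i < (\dim (sa_H A' (sa_tilde A' S))).+1)
        \sum_(j < (\dim (sa_WS A' (sa_tilde A' S))).+1 | P j i) T_bipart A' S i j)%VS}.
Proof.
move=> t tS; rewrite -(lfunE (gale_T S)) memv_preim; apply: (subvP _ t tS).
apply/subv_sumP => i _; apply/subv_sumP => j Pij; apply/subvP => x /gale_T_bipart xS.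
rewrite -memv_preim lfunE /=; apply: subvP xS.
have eH : \dim (sa_H A' (sa_tilde A' S)) = \dim (sa_WS A (sa_tilde A S)).
  by rewrite sa_tilde_dual dim_dual_H.
have eW : \dim (sa_WS A' (sa_tilde A' S)) = \dim (sa_H A (sa_tilde A S)).
  by rewrite sa_tilde_dual dim_dual_WS.
apply: (sumv_sup (cast_ord (esym (congr1 succn eH)) j)) => //.
exact: (sumv_sup (cast_ord (esym (congr1 succn eW)) i)).
Qed.

Lemma gale_T_inv_sum S (P : nat -> nat -> bool) :
  {in (\sum_(i < (\dim (sa_H A' (sa_tilde A' S))).+1)
         \sum_(j < (\dim (sa_WS A' (sa_tilde A' S))).+1 | P i j) T_bipart A' S i j)%VS,
   forall t, gale_T_inv S t \in
     (\sum_(i < (\dim (sa_H A (sa_tilde A S))).+1)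
        \sum_(j < (\dim (sa_WS A (sa_tilde A S))).+1 | P j i) T_bipart A S i j)%VS}.
Proof.
move=> t tS; rewrite -(lfunE (gale_T_inv S)) memv_preim; apply: (subvP _ t tS).
apply/subv_sumP => i _; apply/subv_sumP => j Pij; apply/subvP => x /gale_T_inv_bipart xS.
rewrite -memv_preim lfunE /=; apply: subvP xS.
have eH : \dim (sa_H A' (sa_tilde A' S)) = \dim (sa_WS A (sa_tilde A S)).
  by rewrite sa_tilde_dual dim_dual_H.
have eW : \dim (sa_WS A' (sa_tilde A' S)) = \dim (sa_H A (sa_tilde A S)).
  by rewrite sa_tilde_dual dim_dual_WS.
apply: (sumv_sup (cast_ord (congr1 succn eW) j)) => //.
exact: (sumv_sup (cast_ord (congr1 succn eH) i)).
Qed.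

Lemma gale_T_T_S S : {in T_S A S, forall t, gale_T S t \in T_S A' S}.
Proof. exact: (gale_T_sum (P := fun _ _ => true)). Qed.

Lemma gale_T_inv_T_S S : {in T_S A' S, forall t, gale_T_inv S t \in T_S A S}.
Proof. exact: (gale_T_inv_sum (P := fun _ _ => true)). Qed.

Lemma gale_T_inj S : {in T_S A S &, injective (gale_T S)}.
Proof. exact: can_in_inj (@gale_TK S). Qed.

Lemma qdeg_dual S i j : qdeg A' S i j = qdeg A S j i.
Proof.
rewrite /qdeg sa_tilde_dual dim_dual_H dim_dual_WS [(j + i)%N]addnC.
by rewrite -!addrA; congr (_ + _); rewrite addrCA.
Qed.

Lemma gale_T_square S r s t : r \notin S -> s \notin S -> r != s -> t \in T_S A S ->
  gale_T (s |: (r |: S)) (edge_map (A := A) (r |: S) s (edge_map (A := A) S r t)) =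
  edge_map (A := A') (r |: S) s (edge_map (A := A') S r (gale_T S t)).
Proof.
move=> rS sS rs tS; rewrite gale_T_edge ?gale_T_edge ?edge_map_T_S //.
by rewrite !inE negb_or eq_sym rs.
Qed.

(** The edge maps of the two complexes are conjugate, so their squares anticommute for
    the same scalars. *)
Lemma edge_choice_dual eps : edge_choice A eps <-> edge_choice A' eps.
Proof.
split=> -[eps0 anti]; split=> // S r s rS sS rs t tS.
  rewrite -(gale_T_invK tS); set t0 := gale_T_inv S t.
  have t0S : t0 \in T_S A S by apply: gale_T_inv_T_S.
  rewrite -!gale_T_square // 1?eq_sym // -[LHS]linearZ /= anti // linearN linearZ /=.
  by rewrite (setUCA [set r] [set s] S).
have sr : s != r by rewrite eq_sym.
have srS : s \notin r |: S by rewrite !inE negb_or sr.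
have rsS : r \notin s |: S by rewrite !inE negb_or rs.
apply: (@gale_T_inj (s |: (r |: S))).
- by rewrite memvZ // !edge_map_T_S.
- by rewrite memvN memvZ // setUCA !edge_map_T_S.
have := anti _ _ _ rS sS rs _ (gale_T_T_S tS).
rewrite -(gale_T_square rS sS rs tS) -(gale_T_square sS rS sr tS) (setUCA [set r]).
by move=> E; rewrite [LHS]linearZ [RHS]linearN [X in - X]linearZ.
Qed.

Lemma T_iso_dual eps : T_iso A A' eps eps.
Proof.
exists gale_iso; split.
- move=> t u /T_totalP tT /T_totalP uT ftu; apply/ffunP => S.
  apply: gale_T_inj (tT S) (uT S) _.
  by have := congr1 (fun x : {ffun {set 'I_n} -> EA'} => x S) ftu; rewrite /= !gale_isoE.
- apply: limg_gale_iso => S; [exact: gale_T_T_S | exact: gale_T_inv_T_S | exact: subvv].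
- move=> p q.
  pose P := fun S i j => (hdeg S == p) && (qdeg A S i j == q).
  have P'E S i j : P S j i = (hdeg S == p) && (qdeg A' S i j == q).
    by rewrite qdeg_dual.
  apply: limg_gale_iso => S.
  + move=> t /(gale_T_sum (P := P S)).
    by under eq_bigr => i _ do under eq_bigl => j do rewrite P'E.
  + move=> t tS; apply: (gale_T_inv_sum (P := fun i j => P S j i)).
    by under eq_bigr => i _ do under eq_bigl => j do rewrite P'E.
  apply/subv_sumP => i _; apply/subv_sumP => j _.
  by apply: (sumv_sup i) => //; apply: (sumv_sup j).
- move=> t /T_totalP tT; apply/ffunP => S; rewrite gale_isoE !ffunE linear_sum.
  apply: eq_bigr => r rS; rewrite linearZ /= gale_isoE.
  by rewrite -(gale_T_edge _ (tT _)) ?setD1K // !inE eqxx.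
Qed.

End GaleDual.

Theorem proposition3p7 (k : fieldType) (n : nat) (A : signed_arrangement k n)
    (k_char0 : [pchar k] =i pred0)
    (A_spanning : spanning A)
    (A_nondeg : nondegenerate_arrangement A)
    (A_dual_nondeg : nondegenerate_arrangement (gale_dual A)) :
  (forall eps : {set 'I_n} -> 'I_n -> k,
     edge_choice A eps <-> edge_choice (gale_dual A) eps) /\
  (forall eps : {set 'I_n} -> 'I_n -> k,
     edge_choice A eps -> T_iso A (gale_dual A) eps eps).
Proof.
by split=> eps => [|_]; [exact: edge_choice_dual | exact: T_iso_dual].
Qed.
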